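(* Let $k\geq 2$ be an integer and let $G_k(x)=1+\sum_{n\geq 1}\frac{x^n}{n}\binom{kn}{n-1}$. Then, as formal power series, $$\log G_k(x)=\sum_{n\geq 1}\frac{x^n}{n!}\,\frac{(kn-1)!}{(kn-n)!}.$$
   Context: The logarithm of a formal power series with constant term $1$ is the usual formal logarithm. *)

(* Defs.v *)
From mathcomp Require Import all_boot all_order all_algebra.

Set Implicit Arguments.
Unset Strict Implicit.
Unset Printing Implicit Defensive.

Import GRing.Theory.
Local Open Scope ring_scope.

(* A formal power series over the rationals is its sequence of coefficients:  *)
(* f stands for the series whose coefficient of x^n is f n.  Equality of      *)
(* series is pointwise equality, written f =1 g.                              *)
Definition fps : Type := nat -> rat.

Definition fps_one : fps := fun n => (n == 0%N)%:R.

Definition fps_sub (f g : fps) : fps := fun n => f n - g n.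

Definition fps_mul (f g : fps) : fps :=
  fun n => \sum_(i < n.+1) f i * g (n - i)%N.

Definition fps_pow (f : fps) (m : nat) : fps := iter m (fps_mul f) fps_one.

(* log f = \sum_(m >= 1) (-1)^(m-1) (f - 1)^m / m.  This is meaningful when   *)
(* f has constant term 1: then (f - 1)^m has no term of degree < m            *)
(* (fps_pow_lt below), so only the m <= n contribute to the coefficient of    *)
(* x^n, and the sum below is the whole sum.                                   *)
Definition fps_log (f : fps) : fps :=
  fun n => \sum_(1 <= m < n.+1)
    (-1) ^+ m.-1 / m%:R * fps_pow (fps_sub f fps_one) m n.

Lemma fps_pow_lt (f : fps) (m n : nat) :
  f 0%N = 1 -> (n < m)%N -> fps_pow (fps_sub f fps_one) m n = 0.
Proof.
move=> f0; elim: m n => [//|m IHm] n; rewrite ltnS => le_nm.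
rewrite /fps_pow iterS {1}/fps_mul big1 // => -[[|i] lt_in] _ /=.
  by rewrite /fps_sub /fps_one f0 subrr mul0r.
rewrite [X in _ * X](IHm (n - i.+1)%N) ?mulr0 //.
by apply: leq_trans le_nm; rewrite ltn_subrL (leq_trans _ (lt_in : i < n)%N).
Qed.

Definition G (k : nat) : fps :=
  fun n => if n is 0%N then 1 else 'C(k * n, n.-1)%:R / n%:R.

(* Main.v *)
(* The coefficients of powers of G_k are the Raney numbers                    *)
(* R_n(p) = [x^n] G_k^p = p / (p + kn) * C(p + kn, n).  The functional        *)
(* equation G_k = 1 + x G_k^k gives R_(n+1)(p+1) = R_(n+1)(p) + R_n(p+k),     *)
(* from which both the convolution law and the closed form follow by          *)
(* induction.  Hence (G_k - 1)^m = x^m G_k^(km) has n-th coefficient          *)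
(* m / n * C(kn, n - m), and the n-th coefficient of log G_k is 1 / n times   *)
(* an alternating sum of binomials that telescopes to C(kn - 1, n - 1).       *)
Require Import Defs.
From mathcomp Require Import all_boot all_order all_algebra.
From mathcomp Require Import ring.

Import GRing.Theory Num.Theory.
Local Open Scope ring_scope.

(** The Raney numbers are defined by their recurrence alone. [raney_closed] identifies G_k - 1 with
    x times the series of [raney k n k], and [raney_conv] then gives its powers ([fps_pow_G]). In
    the logarithm the factor 1/m cancels, leaving [alternating_sum_bin]. *)

(* Summing the recurrence over p makes n the only recursive argument. *)
Fixpoint raney (k n p : nat) : nat :=
  if n is n'.+1 then (\sum_(i < p) raney k n' (i + k))%N else 1%N.

Lemma raney0 (k p : nat) : raney k 0 p = 1%N.
Proof. by []. Qed.

Lemma raneyS0 (k n : nat) : raney k n.+1 0 = 0%N.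
Proof. by rewrite /= big_ord0. Qed.

Lemma raneySS (k n p : nat) :
  raney k n.+1 p.+1 = (raney k n.+1 p + raney k n (p + k))%N.
Proof. by rewrite /= big_ord_recr. Qed.

(** Both sides obey the recurrence [raneySS] in p: the increment of the left side is the convolution
    at n with p + k, known from the outer induction. *)
Lemma raney_conv (k n p q : nat) :
  (\sum_(i < n.+1) raney k i p * raney k (n - i) q = raney k n (p + q))%N.
Proof.
elim: n p => [|n IHn] p; first by rewrite big_ord1.
elim: p => [|p IHp].
  rewrite big_ord_recl raney0 mul1n subn0 big1 ?addn0 // => i _.
  by rewrite raneyS0.
rewrite addSn raneySS -IHp [(p + q + k)%N]addnAC -IHn.
rewrite big_ord_recl [in RHS]big_ord_recl !raney0 -addnA.
congr addn; rewrite -big_split; apply: eq_bigr => i _.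
by rewrite raneySS mulnDl.
Qed.

Lemma raney_closed (k n p : nat) : (0 < k)%N ->
  ((p + k * n) * raney k n p = p * 'C(p + k * n, n))%N.
Proof.
move=> k_gt0; elim: n p => [|n IHn] p; first by rewrite muln0 addn0 raney0 bin0.
elim: p => [|p IHp]; first by rewrite raneyS0 muln0.
have := IHn (p + k)%N; rewrite -addnA -mulnS => IHn'.
have M_gt0 : (0 < p + k * n.+1)%N by rewrite addn_gt0 muln_gt0 k_gt0 orbT.
have le_nM : (n <= p + k * n.+1)%N by rewrite ltnW // ltn_addl // leq_pmull.
have defM : (p + k * n.+1)%:R = p%:R + k%:R * n.+1%:R :> rat.
  by rewrite natrD natrM.
rewrite addSn; move: (p + k * n.+1)%N defM M_gt0 le_nM IHp IHn'.
move=> M defM M_gt0 le_nM IHp IHn'.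
have binM := mul_bin_left M n.
(* The factor M lets [IHp] and [IHn'] replace both Raney summands by binomials. *)
rewrite raneySS binS; apply/eqP; rewrite -(eqn_pmul2l M_gt0).
rewrite -(eqr_nat rat) !natrM !natrD -subr_eq0; apply/eqP.
move: IHp IHn' binM => /(congr1 (fun x => x%:R : rat)) +
  /(congr1 (fun x => x%:R : rat)) + /(congr1 (fun x => x%:R : rat)).
rewrite !natrM natrD natrB // => IHp IHn' binM.
rewrite mulrCA mulrDr IHp IHn' -[M.+1%:R]natr1 -[p.+1%:R]natr1.
(* The coefficient of C(M, n+1) is (M+1)p - M(p+1) = -k(n+1), so [binM] turns that term into a
   multiple of C(M, n). *)
transitivity ((M%:R - n%:R) * 'C(M, n)%:R * - k%:R
   + ((M%:R + 1) * (p%:R + k%:R) - M%:R * (p%:R + 1)) * 'C(M, n)%:R : rat).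
  by rewrite -binM defM; ring.
by rewrite defM -natr1; ring.
Qed.

Lemma G_raney (k n : nat) : (0 < k)%N -> G k n.+1 = (raney k n k)%:R.
Proof.
move=> k_gt0; have := raney_closed k n k k_gt0; rewrite -mulnS -mulnA.
move/eqP; rewrite eqn_pmul2l // => /eqP eq_bin.
by rewrite /= -eq_bin natrM mulrC mulKf // pnatr_eq0.
Qed.

Lemma fps_pow_G (k m j : nat) : (0 < k)%N ->
  fps_pow (fps_sub (G k) fps_one) m (m + j)%N = (raney k j (k * m))%:R.
Proof.
move=> k_gt0; elim: m j => [|m IHm] j.
  by rewrite muln0; case: j => [|j] //; rewrite raneyS0.
rewrite /fps_pow iterS {1}/fps_mul -/(fps_pow _ m) big_ord_recl.
rewrite {1}/fps_sub subrr mul0r add0r addSn -addnS addnC.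
(* The last m terms vanish: there the m-th power is read below degree m. *)
rewrite big_split_ord [LHS]addrC big1 ?add0r => [|i _]; last first.
  rewrite (@fps_pow_lt (G k)) ?mulr0 // lift0.
  rewrite -[nat_of_ord (rshift _ _)]/(j.+1 + i)%N -addnS subnDl.
  by rewrite ltn_subrL (leq_ltn_trans _ (ltn_ord i)).
rewrite mulnS -raney_conv natr_sum; apply: eq_bigr => i _.
have le_ij : (i <= j)%N by rewrite -ltnS.
rewrite lift0 -[nat_of_ord (lshift _ _)]/(nat_of_ord i) addSn subSS.
by rewrite addnC -addnBA // IHm /fps_sub G_raney // subr0 natrM.
Qed.

(** Pascal's rule applied to the leading term makes the sum telescope. *)
Lemma alternating_sum_bin (N n : nat) :
  \sum_(i < n.+1) (-1) ^+ i * 'C(N.+1, n - i)%:R = 'C(N, n)%:R :> rat.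
Proof.
elim: n => [|n IHn]; first by rewrite big_ord1 mul1r !bin0.
rewrite big_ord_recl mul1r subn0 binS natrD -[RHS]addr0 -addrA; congr (_ + _).
rewrite -IHn -big_split big1 // => i _.
by rewrite /= /bump add1n subSS exprS mulN1r mulNr subrr.
Qed.

Theorem theorem8 (k : nat) (hk : (2 <= k)%N) :
  fps_log (G k) =1
    (fun n => if n is 0%N then 0
              else n`!%:R^-1 * ((k * n - 1)`!%:R / (k * n - n)`!%:R)).
Proof.
have k_gt0 : (0 < k)%N := ltnW hk.
case=> [|n]; first by rewrite /fps_log big_geq.
have kn_gt0 : (0 < k * n.+1)%N by rewrite muln_gt0 k_gt0.
have [N defN] : exists N, (k * n.+1 = N.+1)%N by exists (k * n.+1).-1; rewrite prednK.
have le_nN : (n <= N)%N by rewrite -ltnS -defN leq_pmull.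
transitivity ('C(N, n)%:R / n.+1%:R : rat).
  rewrite /fps_log big_add1 big_mkord -alternating_sum_bin mulr_suml.
  apply: eq_bigr => i _; have le_in : (i < n.+1)%N := ltn_ord i.
  have := fps_pow_G k i.+1 (n.+1 - i.+1) k_gt0.
  rewrite subnKC // => ->; rewrite -mulrA -mulrA; congr (_ * _).
  (* With m = i+1 and p = km, p + k(n+1-m) = k(n+1); cancelling k leaves the coefficient m/(n+1) *
     C(k(n+1), n+1-m), whose m absorbs the 1/m of the logarithm. *)
  have := raney_closed k (n.+1 - i.+1) (k * i.+1) k_gt0.
  rewrite -mulnDr subnKC // -!mulnA => /eqP; rewrite eqn_pmul2l // => /eqP.
  rewrite -defN subSS => /(congr1 (fun x => x%:R : rat)); rewrite !natrM => eqB.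
  apply: (mulfI (x := i.+1%:R)); first by rewrite pnatr_eq0.
  by rewrite mulVKf ?pnatr_eq0 // mulrA -eqB mulrC mulKf // pnatr_eq0.
rewrite defN subn1 subSS factS -(bin_fact le_nN) !natrM.
have nz m : m`!%:R != 0 :> rat by rewrite pnatr_eq0 -lt0n fact_gt0.
have n1nz : n.+1%:R != 0 :> rat by rewrite pnatr_eq0.
by field; rewrite !nz addrC natr1 n1nz.
Qed.
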